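(* Let $n,r\in\mathbb{N}$ with $r\geq 2$, let $E$ be a nontrivial uniformly complete Archimedean real vector lattice, and let $Y$ be a real separated convex bornological space. Suppose $S\colon E^r\to Y$ is a bounded power sum polynomial of degree $n$ in $r$ variables. Then the following are equivalent. (i) $S$ is orthogonally steady. (ii) $S$ is total orderization invariant. (iii) $S$ is positively total orderization invariant.
   Context: $\mathbb{N}$ is the set of strictly positive integers and $[r]:=\{1,\dots,r\}$; nontrivial means $E\neq\{0\}$; $E^+$ is the positive cone of $E$. Uniformly complete means relatively uniformly complete: for every $u\in E^+$, every $u$-uniformly Cauchy sequence converges $u$-uniformly in $E$. A real convex bornological space is a real vector space $Y$ with a family of subsets (called bounded) that covers $Y$ and is closed under passing to subsets, finite unions, vector sums, multiplication by scalars, balanced hulls and convex hulls; it is separated if $\{0\}$ is the only bounded vector subspace. The vector lattice $E$ carries the bornology of order bounded sets, and a map $E^r\to Y$ is bounded if it maps products of order bounded subsets of $E$ to bounded subsets of $Y$. An $n$-homogeneous polynomial $P\colon E\to Y$ is a map of the form $P(f)=\varphi(f,\dots,f)$ for some $n$-linear map $\varphi\colon E^n\to Y$. A power sum polynomial of degree $n$ in $r$ variables is a map $S\colon E^r\to Y$ of the form $S(f_1,\dots,f_r)=\sum_{k=1}^r P(f_k)$ with $P\colon E\to Y$ an $n$-homogeneous polynomial. It is orthogonally steady if $S(f_1,\dots,f_r)=S(0,f_1,\dots,f_i+f_j,\dots,f_r)$ whenever $f_1,\dots,f_r\in E$ and $i,j\in[r]$ with $i\neq j$ satisfy $|f_i|\wedge|f_j|=0$;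 here on the right-hand side the two entries $f_i,f_j$ are replaced by the two entries $0$ and $f_i+f_j$, and all other entries are kept. For $f_1,\dots,f_r\in E$ and $k\in[r]$, $$\mathcal{M}_k(f_1,\dots,f_r)=\bigvee_{\substack{i_1,\dots,i_{r+1-k}\in[r]\\ i_1<i_2<\cdots<i_{r+1-k}}}\ \bigwedge_{j=1}^{r+1-k}f_{i_j}.$$ A map $S\colon E^r\to Y$ is total orderization invariant if $$S(f_1,\dots,f_r)=S\bigl(\mathcal{M}_1(f_1,\dots,f_r),\dots,\mathcal{M}_r(f_1,\dots,f_r)\bigr)$$ for all $f_1,\dots,f_r\in E$, and positively total orderization invariant if this identity holds for all $f_1,\dots,f_r\in E^+$. *)

(* Defs.v *)
From HB Require Import structures.
From mathcomp Require Import all_boot all_order all_algebra.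
From mathcomp Require Import boolp classical_sets reals convex.

Set Implicit Arguments.
Unset Strict Implicit.
Unset Printing Implicit Defensive.

Import Order.TTheory GRing.Theory Num.Theory.

Local Open Scope classical_set_scope.
Local Open Scope ring_scope.

(* vmeet and vjoin are new operations, not those of Order.Lattice: HB rejects a
   structure inheriting from both Order.Lattice and GRing.Lmodule, for want of
   an intermediate structure below Num.RealDomain. *)
HB.mixin Record Lmodule_isVectorLattice (R : realType) E
    & Num.POrderedZmodule E & GRing.Lmodule R E := {
  lev_wpD2r : forall z x y : E, x <= y -> x + z <= y + z ;
  scalev_ge0 : forall (a : R) (x : E), 0 <= a -> 0 <= x -> 0 <= a *: x ;
  vmeet : E -> E -> E ;
  vjoin : E -> E -> E ;
  lev_meet : forall x y z : E, (x <= vmeet y z) = (x <= y) && (x <= z) ;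
  lev_join : forall x y z : E, (vjoin x y <= z) = (x <= z) && (y <= z) ;
}.

#[short(type="vectorLatticeType")]
HB.structure Definition VectorLattice (R : realType) :=
  { E of Num.POrderedZmodule E & GRing.Lmodule R E
       & Lmodule_isVectorLattice R E }.

Section VectorLattice.
Context {R : realType} {E : vectorLatticeType R}.
Implicit Types (x y u : E) (f : nat -> E) (A : set E).

(* The absolute value of a vector lattice is E-valued, unlike `|x|. *)
Definition vabs x : E := vjoin x (- x).

Definition order_bounded A : Prop :=
  exists x y, A `<=` [set z | x <= z <= y].

Definition unif_cauchy u f : Prop :=
  forall e : R, 0 < e -> exists N, forall p q,
    (N <= p)%N -> (N <= q)%N -> vabs (f p - f q) <= e *: u.

Definition unif_cvg u f x : Prop :=
  forall e : R, 0 < e -> exists N, forall p,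
    (N <= p)%N -> vabs (f p - x) <= e *: u.

End VectorLattice.

Definition nontrivial {R : realType} (E : vectorLatticeType R) : Prop :=
  exists x : E, x != 0.

Definition archimedean {R : realType} (E : vectorLatticeType R) : Prop :=
  forall x y : E, 0 <= x -> (forall k : nat, x *+ k <= y) -> x = 0.

Definition unif_complete {R : realType} (E : vectorLatticeType R) : Prop :=
  forall u : E, 0 <= u ->
  forall f : nat -> E, unif_cauchy u f -> exists x, unif_cvg u f x.

Section Hulls.
Context {R : realType} {Y : lmodType R}.
Implicit Types A : set Y.

Definition balanced A : Prop :=
  forall a : R, `|a| <= 1 -> [set a *: y | y in A] `<=` A.

Definition balanced_hull A : set Y := smallest balanced A.

Definition convex_hull A : set Y := smallest (@convex_set R Y) A.

End Hulls.

HB.mixin Record Lmodule_isConvexBornological (R : realType) Y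
    & GRing.Lmodule R Y := {
  bornology : set (set Y) ;
  bornology_cover : \bigcup_(B in bornology) B = setT ;
  bornologyS : forall A B : set Y, A `<=` B -> bornology B -> bornology A ;
  bornologyU : forall A B : set Y,
    bornology A -> bornology B -> bornology (A `|` B) ;
  bornologyD : forall A B : set Y,
    bornology A -> bornology B -> bornology [set x + y | x in A & y in B] ;
  bornologyZ : forall (a : R) (A : set Y),
    bornology A -> bornology [set a *: y | y in A] ;
  bornology_balanced : forall A : set Y,
    bornology A -> bornology (balanced_hull A) ;
  bornology_convex : forall A : set Y,
    bornology A -> bornology (convex_hull A) ;
}.

#[short(type="convexBornologicalType")]
HB.structure Definition ConvexBornological (R : realType) :=
  { Y of GRing.Lmodule R Y & Lmodule_isConvexBornological R Y }.

Definition separated_bornology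
    {R : realType} (Y : convexBornologicalType R) : Prop :=
  forall U : set Y, submod_closed (mem U) -> bornology U -> U = [set 0].

Section PowerSumPolynomials.
Context {R : realType} {E : vectorLatticeType R}.

Definition multilinear {Y : lmodType R} n (phi : ('I_n -> E) -> Y) : Prop :=
  forall i f, linear (fun x : E => phi [eta f with i |-> x]).

Definition homogeneous_polynomial {Y : lmodType R} n (P : E -> Y) : Prop :=
  exists2 phi : ('I_n -> E) -> Y,
    multilinear phi & forall x, P x = phi (fun=> x).

Definition power_sum_polynomial {Y : lmodType R} n r
    (S : ('I_r -> E) -> Y) : Prop :=
  exists2 P : E -> Y,
    homogeneous_polynomial n P & forall f, S f = \sum_(k < r) P (f k).

Definition bounded_map {Y : convexBornologicalType R} r
    (S : ('I_r -> E) -> Y) : Prop :=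
  forall B : 'I_r -> set E, (forall k, order_bounded (B k)) ->
    bornology (S @` [set f | forall k, B k (f k)]).

(* Power sums are symmetric, so it does not matter at which of the positions
   i and j the entries 0 and f i + f j are put. *)
Definition orthogonally_steady {Y : lmodType R} r
    (S : ('I_r -> E) -> Y) : Prop :=
  forall (f : 'I_r -> E) (i j : 'I_r), i != j ->
    vmeet (vabs (f i)) (vabs (f j)) = 0 ->
    S f = S [eta f with i |-> 0, j |-> f i + f j].

(* E need not have a least or a greatest element, so finite meets and joins
   only make sense for nonempty sequences; the value at [::] is junk. *)
Definition vmeets (s : seq E) : E :=
  if s is x :: s' then \big[vmeet/x]_(y <- s') y else 0.

Definition vjoins (s : seq E) : E :=
  if s is x :: s' then \big[vjoin/x]_(y <- s') y else 0.

(* Indices start at 0: for k : 'I_r this is the (k + 1)-st order statistic,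
   the join over all i_1 < ... < i_(r - k) of the meets of the f i_j. *)
Definition orderization r (f : 'I_r -> E) (k : 'I_r) : E :=
  vjoins [seq vmeets [seq f i | i <- t]
        | t : (r - k).-tuple 'I_r <- enum {: (r - k).-tuple 'I_r}
        & sorted ltn [seq val i | i <- t]].

Definition total_orderization_invariant {Y : lmodType R} r
    (S : ('I_r -> E) -> Y) : Prop :=
  forall f, S f = S (orderization f).

Definition positively_total_orderization_invariant {Y : lmodType R} r
    (S : ('I_r -> E) -> Y) : Prop :=
  forall f, (forall k, 0 <= f k) -> S f = S (orderization f).

End PowerSumPolynomials.

(* Main.v *)
Require Import Defs.
From mathcomp Require Import all_boot all_order all_algebra.
From mathcomp Require Import boolp classical_sets reals.
From mathcomp Require Import zify.

(* Write S f = sum_k P (f k). Each of (i)-(iii) says that P is additive on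
   disjoint pairs, and the substance is that such a P is a valuation,
   P (x /\ y) + P (x \/ y) = P x + P y; sorting by comparators then gives (ii).
   With m = x /\ y, a = x - m and b = y - m, the valuation identity is the
   vanishing at m of the second difference of P along the disjoint pair a, b.
   Let Phi(x_1, ..., x_n) be the n-th difference of P, a symmetric n-additive
   form. Disjoint additivity kills Phi when the arguments split into two
   mutually disjoint nonempty groups u and v. A further argument h >= 0 is
   absorbed by splitting it as h /\ M + (h - h /\ M), where M is a sum of
   multiples N x of the x in u: the first part is disjoint from v, and the
   second from the truncations N x - N x /\ h. As N x differs from its
   truncation by an element of [0, h] for every N, boundedness of P and
   separation of Y remove the truncations. So Phi vanishes as soon as two of
   its arguments are disjoint, and homogeneity of P carries this down to
   differences of order less than n. *)

Set Implicit Arguments.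
Unset Strict Implicit.
Unset Printing Implicit Defensive.

Import Order.TTheory GRing.Theory Num.Theory.

Local Open Scope ring_scope.

(** * Order arithmetic and disjointness in a vector lattice *)

Section VectorLatticeTheory.
Context {R : realType} {E : vectorLatticeType R}.
Implicit Types x y z h a b c : E.

Lemma lev_D2r z x y : (x + z <= y + z) = (x <= y).
Proof.
apply/idP/idP => [le_xz|]; last exact: lev_wpD2r.
by rewrite -(addrK z x) -(addrK z y) lev_wpD2r.
Qed.

Lemma lev_D2l z x y : (z + x <= z + y) = (x <= y).
Proof. by rewrite ![z + _]addrC lev_D2r. Qed.

Lemma levD x y z t : x <= y -> z <= t -> x + z <= y + t.
Proof.
by move=> le_xy le_zt; apply: (@le_trans _ _ (y + z)); rewrite ?lev_D2r ?lev_D2l.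
Qed.

Lemma subv_ge0 x y : (0 <= y - x) = (x <= y).
Proof. by rewrite -(lev_D2r x 0) add0r subrK. Qed.

Lemma lev_BlDr x y z : (x - y <= z) = (x <= z + y).
Proof. by rewrite -(lev_D2r y (_ - _)) subrK. Qed.

Lemma lev_BrDr x y z : (x <= z - y) = (x + y <= z).
Proof. by rewrite -(lev_D2r y x) subrK. Qed.

Lemma lev_N2 x y : (- x <= - y) = (y <= x).
Proof. by rewrite -(subv_ge0 (- x)) opprK addrC subv_ge0. Qed.

Lemma addv_ge0 x y : 0 <= x -> 0 <= y -> 0 <= x + y.
Proof. by move=> x0 y0; rewrite -(addr0 0) levD. Qed.

Lemma mulvn_ge0 x N : 0 <= x -> 0 <= x *+ N.
Proof.
by move=> x0; elim: N => [|N IH]; rewrite ?mulr0n // mulrS addv_ge0.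
Qed.

Lemma sumv_ge0 (I : eqType) (s : seq I) (F : I -> E) :
  (forall i, i \in s -> 0 <= F i) -> 0 <= \sum_(i <- s) F i.
Proof.
move=> F0; rewrite big_seq.
by elim/big_rec: _ => // i x si x0; rewrite addv_ge0 ?F0.
Qed.

Lemma lev_sum_elem (I : eqType) (s : seq I) (F : I -> E) i :
  (forall i, i \in s -> 0 <= F i) -> i \in s -> F i <= \sum_(j <- s) F j.
Proof.
elim: s => // j s IH F0; rewrite big_cons inE => /orP[/eqP ->|si].
  rewrite -[leLHS]addr0 lev_D2l sumv_ge0 // => k sk.
  by rewrite F0 // inE sk orbT.
rewrite -[leLHS]add0r levD ?F0 ?mem_head ?IH // => k sk.
by rewrite F0 // inE sk orbT.
Qed.

Lemma vmeet_lel x y : vmeet x y <= x.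
Proof. by have := lexx (vmeet x y); rewrite lev_meet => /andP[]. Qed.

Lemma vmeet_ler x y : vmeet x y <= y.
Proof. by have := lexx (vmeet x y); rewrite lev_meet => /andP[]. Qed.

Lemma vjoin_gel x y : x <= vjoin x y.
Proof. by have := lexx (vjoin x y); rewrite lev_join => /andP[]. Qed.

Lemma vjoin_ger x y : y <= vjoin x y.
Proof. by have := lexx (vjoin x y); rewrite lev_join => /andP[]. Qed.

Lemma eq_vmeet x y m :
  (forall z, (z <= m) = (z <= x) && (z <= y)) -> vmeet x y = m.
Proof.
move=> mP; apply/eqP; rewrite eq_le mP vmeet_lel vmeet_ler /= lev_meet.
by rewrite -mP lexx.
Qed.

Lemma eq_vjoin x y m :
  (forall z, (m <= z) = (x <= z) && (y <= z)) -> vjoin x y = m.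
Proof.
move=> mP; apply/eqP; rewrite eq_le mP vjoin_gel vjoin_ger lev_join.
by rewrite -mP lexx.
Qed.

Lemma vmeetC x y : vmeet x y = vmeet y x.
Proof. by apply: eq_vmeet => z; rewrite lev_meet andbC. Qed.

Lemma vjoinC x y : vjoin x y = vjoin y x.
Proof. by apply: eq_vjoin => z; rewrite lev_join andbC. Qed.

Lemma vmeetA x y z : vmeet x (vmeet y z) = vmeet (vmeet x y) z.
Proof. by apply: eq_vmeet => t; rewrite !lev_meet andbA. Qed.

Lemma vmeet_l x y : x <= y -> vmeet x y = x.
Proof.
by move=> le_xy; apply: eq_vmeet => z; case: (boolP (z <= x)) => //= /le_trans->.
Qed.

Lemma vjoin_r x y : x <= y -> vjoin x y = y.
Proof.
move=> le_xy; apply: eq_vjoin => z.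
by case: (boolP (y <= z)) => [/(le_trans le_xy)->|_]; rewrite ?andbF.
Qed.

Lemma vmeetDr x y z : vmeet x y + z = vmeet (x + z) (y + z).
Proof.
by apply/esym/eq_vmeet => t; rewrite -!lev_BlDr lev_meet.
Qed.

Lemma vmeetN x y : vmeet (- x) (- y) = - vjoin x y.
Proof.
by apply: eq_vmeet => z; rewrite -(opprK z) !lev_N2 lev_join.
Qed.

Lemma vmeetDjoin x y : vmeet x y + vjoin x y = x + y.
Proof.
suff <- : x + y - vjoin x y = vmeet x y by rewrite subrK.
by rewrite -vmeetN addrC vmeetDr addKr addrCA addNr addr0 vmeetC.
Qed.

(** Distributivity comes from the group: with [j] the join of [y] and [z], [vmeetDjoin] turns an
    upper bound of [vmeet x w] into one of [w], common to [w = y] and [w = z], hence valid for [j],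
    and then turns it back. *)
Lemma vmeet_joinr x y z : vmeet x (vjoin y z) = vjoin (vmeet x y) (vmeet x z).
Proof.
apply/esym/eq_vjoin => t; apply/idP/andP => [le_t|[le_y le_z]].
  by split; apply: le_trans le_t; rewrite lev_meet vmeet_lel /=;
    apply: le_trans (vmeet_ler _ _) _; rewrite ?vjoin_gel ?vjoin_ger.
set j := vjoin y z.
have step w : w <= j -> vmeet x w <= t -> w <= t + vjoin x j - x.
  move=> le_wj le_wt; rewrite lev_BrDr addrC -(vmeetDjoin x w).
  by apply: levD; rewrite // lev_join vjoin_gel (le_trans le_wj) ?vjoin_ger.
have : j <= t + vjoin x j - x.
  by rewrite {1}/j lev_join !step ?vjoin_gel ?vjoin_ger.
by rewrite lev_BrDr addrC -(vmeetDjoin x j) lev_D2r.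
Qed.

Lemma vmeet_joinl x y z : vmeet (vjoin x y) z = vjoin (vmeet x z) (vmeet y z).
Proof. by rewrite ![vmeet _ z]vmeetC vmeet_joinr. Qed.

Lemma vmeet_eq0_le x y z t : 0 <= x -> 0 <= y -> x <= z -> y <= t ->
  vmeet z t = 0 -> vmeet x y = 0.
Proof.
move=> x0 y0 le_xz le_yt zt0; apply/eqP; rewrite eq_le lev_meet x0 y0 andbT.
by rewrite -zt0 lev_meet (le_trans (vmeet_lel _ _)) ?(le_trans (vmeet_ler _ _)).
Qed.

Lemma vmeet0D x y z : 0 <= x -> 0 <= y -> 0 <= z ->
  vmeet x z = 0 -> vmeet y z = 0 -> vmeet (x + y) z = 0.
Proof.
move=> x0 y0 z0 xz0 yz0; apply/eqP.
rewrite eq_le lev_meet addv_ge0 ?z0 //= andbT.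
set m := vmeet _ _; rewrite -yz0 lev_meet vmeet_ler andbT.
have : m - y <= vmeet x z.
  rewrite lev_meet !lev_BlDr vmeet_lel (le_trans (vmeet_ler _ _)) //.
  by rewrite -[leLHS]addr0 lev_D2l.
by rewrite xz0 lev_BlDr add0r.
Qed.

Lemma vmeet0_sum (I : eqType) (s : seq I) (F : I -> E) z : 0 <= z ->
  (forall i, i \in s -> 0 <= F i /\ vmeet (F i) z = 0) ->
  vmeet (\sum_(i <- s) F i) z = 0.
Proof.
move=> z0; elim: s => [|i s IH] F0; first by rewrite big_nil vmeet_l.
rewrite big_cons; have [Fi0 Fiz] := F0 i (mem_head _ _).
have F0' j : j \in s -> 0 <= F j /\ vmeet (F j) z = 0.
  by move=> sj; apply: F0; rewrite inE sj orbT.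
by rewrite vmeet0D ?IH // sumv_ge0 // => j /F0'[].
Qed.

Lemma vmeet0_muln x z N : 0 <= x -> 0 <= z ->
  vmeet x z = 0 -> vmeet (x *+ N) z = 0.
Proof.
move=> x0 z0 xz0; elim: N => [|N IH]; first by rewrite mulr0n vmeet_l.
by rewrite mulrS vmeet0D ?mulvn_ge0.
Qed.

Lemma vmeet_subm x y : vmeet (x - vmeet x y) (y - vmeet x y) = 0.
Proof. by rewrite -vmeetDr subrr. Qed.

Lemma vjoin_vmeet0 a b : vmeet a b = 0 -> vjoin a b = a + b.
Proof. by move=> ab0; rewrite -vmeetDjoin ab0 add0r. Qed.

Lemma vabs_ge0 a : 0 <= a -> vabs a = a.
Proof.
by move=> a0; rewrite /vabs vjoinC vjoin_r // (le_trans _ a0) // -oppr0 lev_N2.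
Qed.

End VectorLatticeTheory.

(** * Sorting by comparators and order statistics *)

Section LatticeSort.
Context {R : realType} {E : vectorLatticeType R}.
Implicit Types (x y z a b c : E) (s t : seq E).

(** The order is only partial, so insertion uses comparators, which send a pair to its meet and
    join; the join is carried on. *)
Fixpoint vinsert x s : seq E :=
  if s is y :: t then vmeet x y :: vinsert (vjoin x y) t else [:: x].

Definition vsort s : seq E := foldr vinsert [::] s.

Lemma size_vinsert x s : size (vinsert x s) = (size s).+1.
Proof. by elim: s x => //= y s IH x; rewrite IH. Qed.

Lemma size_vsort s : size (vsort s) = size s.
Proof. by elim: s => //= x s <-; rewrite size_vinsert. Qed.

Lemma path_vinsert a x s :
  a <= x -> path <=%O a s -> path <=%O a (vinsert x s).
Proof.
elim: s a x => [|y s IH] a x ax /=; first by rewrite ax.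
move=> /andP[ay ys]; rewrite lev_meet ax ay IH //.
  exact: le_trans (vmeet_lel _ _) (vjoin_gel _ _).
by case: s ys {IH} => //= z s /andP[yz ->]; rewrite (le_trans (vmeet_ler x y)).
Qed.

Lemma sorted_vinsert x s : sorted <=%O s -> sorted <=%O (vinsert x s).
Proof.
case: s => //= y s ys; apply: path_vinsert.
  exact: le_trans (vmeet_lel _ _) (vjoin_gel _ _).
by case: s ys => //= z s /andP[yz ->]; rewrite (le_trans (vmeet_ler x y)).
Qed.

Lemma sorted_vsort s : sorted <=%O (vsort s).
Proof. by elim: s => //= x s; apply: sorted_vinsert. Qed.

Lemma all_vinsert_le x s c :
  x <= c -> all (<= c) s -> all (<= c) (vinsert x s).
Proof.
elim: s x => [|y s IH] x xc /=; first by rewrite xc.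
move=> /andP[yc sc]; rewrite IH // ?andbT ?lev_join ?xc //.
exact: le_trans (vmeet_lel _ _) xc.
Qed.

Lemma all_vsort_le s c : all (<= c) s -> all (<= c) (vsort s).
Proof. by elim: s => //= x s IH /andP[xc /IH]; apply: all_vinsert_le. Qed.

(* The bound c stands for the missing top element as the empty meet. *)
Fixpoint meets_le s m c z {struct s} : bool :=
  if m is m'.+1 then
    if s is x :: t then meets_le t m' (vmeet c x) z && meets_le t m c z
    else true
  else c <= z.

Lemma meets_le0 s c z : meets_le s 0 c z = (c <= z).
Proof. by case: s. Qed.

Lemma meets_leS x t m c z :
  meets_le (x :: t) m.+1 c z = meets_le t m (vmeet c x) z && meets_le t m.+1 c z.
Proof. by []. Qed.

Lemma meets_le_join s m a b z :
  meets_le s m (vjoin a b) z = meets_le s m a z && meets_le s m b z.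
Proof.
elim: s m a b => [|x s IH] [|m] a b //=; rewrite ?lev_join //.
by rewrite vmeet_joinl !IH andbACA.
Qed.

Lemma meets_le_mono s m a b z : a <= b -> meets_le s m b z -> meets_le s m a z.
Proof. by move=> ab; rewrite -{1}(vjoin_r ab) meets_le_join => /andP[]. Qed.

(** Choosing neither or both of the two entries gives the same meets on both sides. When one is
    chosen, distributivity turns the bounds for [x] and [y] into the bound for their join; the one
    for their meet follows by monotonicity. *)
Lemma meets_le_swap x y t m c z :
  meets_le [:: x, y & t] m c z = meets_le [:: vmeet x y, vjoin x y & t] m c z.
Proof.
case: m => [|m] //; rewrite !meets_leS !andbA; congr (_ && _).
rewrite vmeet_joinr meets_le_join andbA; case: m => [|m] /=; last first.
  have -> : vmeet (vmeet c (vmeet x y)) (vjoin x y) = vmeet (vmeet c x) y.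
    rewrite -vmeetA [vmeet (vmeet x y) _]vmeet_l ?vmeetA //.
    exact: le_trans (vmeet_lel _ _) (vjoin_gel _ _).
  rewrite -!andbA; congr (_ && _).
  apply/idP/idP => [/andP[cx ->]|/and3P[_ -> //]].
  by rewrite cx (meets_le_mono _ cx) // vmeetA vmeet_lel.
rewrite !meets_le0; apply/idP/idP => [/andP[cx ->]|/andP[/andP[_ ->]]//].
by rewrite cx vmeetA (le_trans (vmeet_lel _ _)).
Qed.

Lemma meets_le_cons x s t : (forall m c z, meets_le s m c z = meets_le t m c z) ->
  forall m c z, meets_le (x :: s) m c z = meets_le (x :: t) m c z.
Proof. by move=> st [|m] c z //=; rewrite !st. Qed.

Lemma meets_le_vinsert x s m c z :
  meets_le (vinsert x s) m c z = meets_le (x :: s) m c z.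
Proof.
elim: s x m c z => // y s IH x m c z; rewrite meets_le_swap.
by apply: (@meets_le_cons _ (vinsert (vjoin x y) s)) => *; apply: IH.
Qed.

Lemma meets_le_vsort s m c z : meets_le (vsort s) m c z = meets_le s m c z.
Proof.
elim: s m c z => // x s IH m c z.
by rewrite /= meets_le_vinsert; apply: meets_le_cons.
Qed.

Lemma meets_le_small s m c z : (size s < m)%N -> meets_le s m c z.
Proof. by elim: s m c => [|x s IH] [|m] c //= sm; rewrite !IH // ltnW. Qed.

Lemma vmeet_le_mono c a b : a <= b -> vmeet c a <= vmeet c b.
Proof. by move=> ab; rewrite lev_meet vmeet_lel (le_trans (vmeet_ler _ _)). Qed.

(** On an increasing chain the largest meet of [m] entries comes from the last [m], whose smallest
    has index [size s - m]. *)
Lemma meets_le_sorted s m c z : sorted <=%O s -> (0 < m <= size s)%N ->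
  meets_le s m c z = (vmeet c (nth 0 s (size s - m)) <= z).
Proof.
elim: s m c => [|x t IH] [|m] c //= xt; rewrite ltnS subSS => mt.
have t_sorted := path_sorted xt.
have x_le i : (i < size t)%N -> x <= nth 0 t i.
  by move=> it; move: xt => /(order_path_min le_trans)/(all_nthP 0)/(_ i it).
have [ltmt|] := ltnP m (size t).
  have -> : (size t - m = (size t - m.+1).+1)%N by lia.
  rewrite [in RHS]/= (IH m.+1) // andb_idl // => le_z.
  apply: (@meets_le_mono _ _ _ (vmeet c (nth 0 t (size t - m.+1)))).
    by apply/vmeet_le_mono/x_le; lia.
  case: m mt ltmt le_z => [|m] mt ltmt le_z; first by rewrite meets_le0.
  by rewrite IH // ?(ltnW ltmt) // (le_trans (vmeet_lel _ _)).
move=> tm; have -> : m = size t by lia.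
rewrite (@meets_le_small _ (size t).+1) // andbT subnn /=.
case: (t) IH t_sorted x_le => [|y t'] IH t_sorted x_le; first by rewrite meets_le0.
by rewrite IH //= subnn -vmeetA [vmeet x _]vmeet_l //; apply: (x_le 0%N).
Qed.

Lemma meets_leP (I : eqType) (f : I -> E) (r : seq I) m c z :
  reflect (forall u, subseq u r -> size u = m -> foldl vmeet c (map f u) <= z)
          (meets_le (map f r) m c z).
Proof.
elim: r m c => [|i r IH] m c /=.
  case: m => [|m]; apply: (iffP idP) => //=.
  - by move=> cz u /eqP->.
  - by move=> /(_ [::]); apply.
  - by move=> _ u /eqP->.
case: m => [|m].
  apply: (iffP idP) => [cz u _ /size0nil-> //|/(_ [::])]; apply => //.
apply: (iffP andP) => [[/IH le_i /IH le_r] [//|j u]|le_z].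
  rewrite /=; case: eqP => [-> ur [um]|_ ur um]; first exact: le_i.
  exact: (le_r (j :: u)).
split; apply/IH => u ur um.
  by apply: (le_z (i :: u)); rewrite /= ?eqxx ?um.
by apply: le_z => //; exact: (subseq_trans ur (subseq_cons r i)).
Qed.

Lemma le_vmeets s z : s != [::] -> (z <= vmeets s) = all (>= z) s.
Proof.
case: s => // x s _; rewrite /vmeets /=.
by elim: s => [|y s IH]; rewrite ?big_nil ?big_cons ?andbT //= lev_meet IH andbCA.
Qed.

Lemma vjoins_le s z : s != [::] -> (vjoins s <= z) = all (<= z) s.
Proof.
case: s => // x s _; rewrite /vjoins /=.
by elim: s => [|y s IH]; rewrite ?big_nil ?big_cons ?andbT //= lev_join IH andbCA.
Qed.

Lemma foldl_vmeet s c : s != [::] -> all (<= c) s -> foldl vmeet c s = vmeets s.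
Proof.
move=> s0 sc.
have le_foldl z d t : (z <= foldl vmeet d t) = (z <= d) && all (>= z) t.
  by elim: t d => [|x t IH] d /=; rewrite ?andbT // IH lev_meet andbA.
apply/eqP; rewrite eq_le; apply/andP; split.
  have := lexx (foldl vmeet c s).
  by rewrite {1}le_foldl le_vmeets // => /andP[].
rewrite le_foldl -le_vmeets // lexx andbT.
have := lexx (vmeets s); rewrite {1}le_vmeets //.
by case: s s0 sc => // x s _ /andP[xc _] /andP[/le_trans->].
Qed.

(** A strictly increasing list is determined by its members. This matches the tuples in
    [orderization] with the subsequences in [meets_leP]. *)
Lemma sorted_ltn_subseq r (u : seq 'I_r) :
  sorted ltn [seq val i | i <- u] = subseq u (enum 'I_r).
Proof.
apply/idP/idP => [u_sorted|/(map_subseq val)/subseq_sorted->//].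
- suff -> : u = [seq i <- enum 'I_r | i \in u] by apply: filter_subseq.
  rewrite sorted_map in u_sorted.
  apply: (@irr_sorted_eq _ (relpre val ltn)) => //.
  + by move=> x y z; apply: ltn_trans.
  + by move=> x; apply: ltnn.
  + apply: sorted_filter; first by move=> x y z; apply: ltn_trans.
    by rewrite -sorted_map val_enum_ord iota_ltn_sorted.
  + by move=> i; rewrite mem_filter mem_enum andbT.
- exact: ltn_trans.
- by rewrite val_enum_ord iota_ltn_sorted.
Qed.

(** Both sides have the same upper bounds: comparators preserve the bounds of all meets of [r - k]
    entries, and on the sorted chain these are the bounds of one entry. *)
Lemma orderization_nth r (f : 'I_r -> E) k :
  orderization f k = nth 0 (vsort (codom f)) k.
Proof.
have [c fc] : exists c, forall i, f i <= c.
  (* The sum of the positive parts dominates every entry and replaces a top element. *)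
  exists (\sum_(i <- enum 'I_r) vjoin (f i) 0) => i.
  apply: le_trans (vjoin_gel (f i) 0) _.
  apply: (@lev_sum_elem _ _ _ _ (fun i => vjoin (f i) 0)).
    by move=> j _; apply: vjoin_ger.
  by rewrite mem_enum.
have ltkr := ltn_ord k.
have codomE : codom f = map f (enum 'I_r) by rewrite /codom /image_mem.
have size_codom : size (codom f) = r by rewrite size_map size_enum_ord.
have nth_c : nth 0 (vsort (codom f)) k <= c.
  have : all (<= c) (vsort (codom f)).
    by apply: all_vsort_le; apply/allP => _ /codomP[i ->]; apply: fc.
  by move=> /(all_nthP 0); apply; rewrite size_vsort size_codom.
suff le_iff z : (orderization f k <= z) = (nth 0 (vsort (codom f)) k <= z).
  by apply/eqP; rewrite eq_le le_iff lexx -le_iff lexx.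
have <- : vmeet c (nth 0 (vsort (codom f)) k) = nth 0 (vsort (codom f)) k.
  by rewrite vmeetC vmeet_l.
have kE : k = (size (vsort (codom f)) - (r - k))%N :> nat.
  by rewrite size_vsort size_codom subKn // ltnW.
rewrite [in RHS]kE -meets_le_sorted ?sorted_vsort //; last first.
  by rewrite size_vsort size_codom subn_gt0 ltkr leq_subr.
rewrite meets_le_vsort codomE vjoins_le; last first.
  (* The first [r - k] indices form an admissible tuple, so [vjoins] does not take its junk
     value. *)
  have size_take : size (take (r - k) (enum 'I_r)) == (r - k)%N.
    by rewrite size_takel // size_enum_ord leq_subr.
  rewrite -size_eq0 size_map -lt0n size_filter -has_count.
  apply/hasP; exists (Tuple size_take); first by rewrite mem_enum.
  by rewrite sorted_ltn_subseq take_subseq.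
have foldlE u : size u = (r - k)%N ->
    foldl vmeet c (map f u) = vmeets (map f u).
  move=> sizeu; apply: foldl_vmeet.
    by rewrite -size_eq0 size_map sizeu -lt0n subn_gt0.
  by apply/allP => _ /mapP[i _ ->]; apply: fc.
apply/allP/meets_leP => [le_z u ur sizeu|le_z _ /mapP[t + ->]].
  have /eqP sizeu' := sizeu; rewrite foldlE //.
  apply: le_z; apply/mapP; exists (Tuple sizeu') => //.
  by rewrite mem_filter mem_enum sorted_ltn_subseq ur.
rewrite mem_filter sorted_ltn_subseq => /andP[tr _].
by rewrite -foldlE ?size_tuple //; apply: le_z; rewrite ?size_tuple.
Qed.

(** On such a tuple (iii) compares [P a + P b] with [P (a + b)]. *)
Lemma vsort_disjoint m a b : 0 <= a -> 0 <= b -> vmeet a b = 0 ->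
  vsort (nseq m 0 ++ [:: a; b]) = nseq m.+1 0 ++ [:: a + b].
Proof.
move=> a0 b0 ab0.
have insert0 k : vinsert 0 (nseq k 0 ++ [:: a + b]) = nseq k.+1 0 ++ [:: a + b].
  elim: k => [|k IH] /=; first by rewrite vmeet_l ?vjoin_r ?addv_ge0.
  by rewrite vmeet_l // vjoin_r // IH.
elim: m => [|m IH]; first by rewrite /= ab0 vjoin_vmeet0.
by rewrite [LHS]/= IH insert0.
Qed.

End LatticeSort.

(** * Iterated differences of maps between abelian groups *)

Section IteratedDifferences.
Context {V W : zmodType}.
Implicit Types (x y z h : V) (s t u v : seq V) (F G : V -> W).

Definition diff x F : V -> W := fun h => F (h + x) - F h.

Definition diffs s F : V -> W := foldr diff F s.

Lemma subr_interchange (a b c d : W) : (a - b) - (c - d) = (a - c) - (b - d).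
Proof. by rewrite !opprB addrACA [RHS]addrACA [- b - c]addrC. Qed.

Lemma diffC x y F : diff x (diff y F) = diff y (diff x F).
Proof.
by apply: funext => h; rewrite /diff [h + x + y]addrAC subr_interchange.
Qed.

Lemma diff_diffs x s F : diff x (diffs s F) = diffs s (diff x F).
Proof. by elim: s => //= y s <-; rewrite diffC. Qed.

Lemma diffs_cat s t F : diffs (s ++ t) F = diffs s (diffs t F).
Proof. by rewrite /diffs foldr_cat. Qed.

Lemma diffs_catC s t F : diffs s (diffs t F) = diffs t (diffs s F).
Proof. by elim: s => //= x s ->; rewrite diff_diffs. Qed.

Lemma perm_diffs s t F : perm_eq s t -> diffs s F = diffs t F.
Proof.
move=> st; apply: (@catCA_perm_subst V (V -> W) (fun t => diffs t F)) st.
by move=> s1 s2 s3; rewrite !diffs_cat diffs_catC.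
Qed.

Lemma diffs_sub s F G h :
  diffs s (fun x => F x - G x) h = diffs s F h - diffs s G h.
Proof.
by elim: s h => //= x s IH h; rewrite /diff !IH subr_interchange.
Qed.

Lemma diffs_cst s (c : W) h : s != [::] -> diffs s (fun=> c) h = 0.
Proof.
case: s => // x s _; rewrite /= diff_diffs /diff subrr.
by elim: s h => //= y s IH h; rewrite /diff !IH subr0.
Qed.

(** Additivity in one direction fails by a difference of one order more; where those vanish,
    differences are additive in each direction. *)
Lemma diffsD x y s F h :
  diffs (x + y :: s) F h =
  diffs (x :: s) F h + diffs (y :: s) F h + diffs [:: x, y & s] F h.
Proof.
rewrite /= /diff; set G := diffs s F.
by rewrite addrACA subrr addr0 [RHS]addrC [RHS]addrA subrK [h + (x + y)]addrA.
Qed.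

Lemma diffs_double k F s h : (forall x, F (x *+ 2) = F x *+ k) ->
  diffs (map (fun x => x *+ 2) s) F (h *+ 2) = diffs s F h *+ k.
Proof.
move=> F2; elim: s h => [|x s IH] h //=.
by rewrite /diff -mulrnDl !IH mulrnBl.
Qed.

(** Differences along [Z] cancel the summand [F x], which survives only when [v] is empty. *)
Lemma diffs_sep (X Z : V -> Prop) v F :
  (forall y z, Z y -> Z z -> Z (y + z)) ->
  (forall x y, X x -> Z y -> F (x + y) = F x + F y) ->
  (forall z, z \in v -> Z z) ->
  forall x y, X x -> Z y ->
  diffs v F (x + y) = diffs v F y + (if v is [::] then F x else 0).
Proof.
move=> ZD FD vZ x; elim: v vZ => [|z v IH] vZ y Xx Zy /=.
  by rewrite FD // addrC.
have Zz := vZ z (mem_head _ _).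
have {}IH := IH (fun z1 tv => vZ z1 (mem_behead (s := z :: v) tv)).
have Zyz := ZD _ _ Zy Zz.
by rewrite /diff -addrA !IH // addr0 opprD addrACA subrr addr0.
Qed.

Lemma diffs_cst_on (X : V -> Prop) u F c :
  (forall x y, X x -> X y -> X (x + y)) ->
  (forall x, X x -> F x = c) -> (forall x, x \in u -> X x) ->
  forall x, X x -> diffs u F x = if u is [::] then c else 0.
Proof.
move=> XD Fc; elim: u => [|z u IH] uX x Xx /=; first exact: Fc.
have Xz := uX z (mem_head _ _).
have {}IH := IH (fun z1 tu => uX z1 (mem_behead (s := z :: u) tu)).
have Xxz := XD _ _ Xx Xz.
by rewrite /diff !IH // subrr.
Qed.

(** By [diffs_sep] the difference along [v] is constant on [X], and differences along [u] kill
    constants. *)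
Lemma diffs_cat_eq0 (X Z : V -> Prop) u v F :
  (forall x y, X x -> X y -> X (x + y)) -> X 0 ->
  (forall y z, Z y -> Z z -> Z (y + z)) -> Z 0 ->
  (forall x y, X x -> Z y -> F (x + y) = F x + F y) ->
  (forall x, x \in u -> X x) -> (forall z, z \in v -> Z z) ->
  u != [::] -> v != [::] -> diffs (u ++ v) F 0 = 0.
Proof.
move=> XD X0 ZD Z0 FD uX vZ u0 v0; rewrite diffs_cat.
rewrite (@diffs_cst_on X u _ (diffs v F 0)) //; first by case: u u0 {uX}.
move=> x Xx; rewrite -[x in LHS]addr0 (diffs_sep ZD FD) //.
by case: v v0 {vZ} => // *; rewrite addr0.
Qed.

End IteratedDifferences.

(** * Differences of the diagonal of a multilinear map *)

Section Homogeneous.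
Context {R : realType} {E : vectorLatticeType R} {Y : lmodType R}.
Variables (n : nat) (phi : ('I_n -> E) -> Y).
Hypothesis phi_lin : multilinear phi.
Implicit Types (f g : 'I_n -> E) (x y : E) (i : 'I_n).

Lemma multilinearD i f x y : phi [eta f with i |-> x + y] =
  phi [eta f with i |-> x] + phi [eta f with i |-> y].
Proof. by have := phi_lin i f 1 x y; rewrite !scale1r. Qed.

Lemma multilinearZ i f a x :
  phi [eta f with i |-> a *: x] = a *: phi [eta f with i |-> x].
Proof.
have /(congr1 (+%R^~ (- phi [eta f with i |-> 0]))) := multilinearD i f 0 0.
rewrite addr0 subrr addrK => phi0.
by have := phi_lin i f a x 0; rewrite -phi0 !addr0.
Qed.

Lemma diag_scale a x : phi (fun=> a *: x) = a ^+ n *: phi (fun=> x).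
Proof.
suff phi_lt j : (j <= n)%N ->
    phi (fun k => if (k < j)%N then a *: x else x) = a ^+ j *: phi (fun=> x).
  rewrite -phi_lt //; congr phi; apply: funext => k.
  by rewrite ltn_ord.
elim: j => [|j IH] ltjn; first by rewrite scale1r.
set f := fun k : 'I_n => if (k < j)%N then a *: x else x.
pose i := Ordinal ltjn.
have -> : (fun k : 'I_n => if (k < j.+1)%N then a *: x else x) =
    [eta f with i |-> a *: x].
  apply: funext => k /=; rewrite /f ltnS leq_eqVlt -[k == i]/(k == j :> nat).
  by case: eqP.
rewrite multilinearZ exprS -scalerA -IH ?(ltnW ltjn) // -/f; congr (_ *: phi _).
apply: funext => k /=; case: eqP => // ->.
by rewrite /f ltnn.
Qed.

Let affine (A : {set 'I_n}) f (h : E) : Y :=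
  phi (fun i => (if i \in A then h else 0) + f i).

Let shift (A : {set 'I_n}) f x j : 'I_n -> E :=
  fun i => (if (i \in A) && (i < j)%N then x else 0) + f i.

(** With the slots outside [A] frozen, the form has degree at most [#|A|] in [h]. The difference
    along [x] is taken slot by slot through [shift]: adding [x] in slot [i] changes the value by a
    form with [x] frozen there, hence with one moving slot less. *)
Lemma diffs_affine k (A : {set 'I_n}) f s h : (#|A| < k)%N -> size s = k ->
  diffs s (affine A f) h = 0.
Proof.
elim: k A f s h => // k IH A f [//|x s] h; rewrite ltnS => leAk [sizes].
suff shiftE j : (j <= n)%N ->
    diffs s (affine A (shift A f x j)) h = diffs s (affine A f) h.
  rewrite /= diff_diffs diffs_sub -(shiftE n) //.
  apply/eqP; rewrite subr_eq0; apply/eqP; congr (diffs _ _ _).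
  apply: funext => z; congr phi; apply: funext => i; rewrite /shift ltn_ord andbT.
  by case: ifP => _; rewrite ?addrA // !add0r.
elim: j => [|j IHj] ltjn.
  congr (diffs _ (affine _ _) _); apply: funext => i.
  by rewrite /shift andbF add0r.
rewrite -IHj ?(ltnW ltjn) //; pose i := Ordinal ltjn.
have [Ai|nAi] := boolP (i \in A); last first.
  congr (diffs _ (affine _ _) _); apply: funext => l; rewrite /shift.
  rewrite ltnS leq_eqVlt; case: (eqVneq (l : nat) j) => //= lj.
  by rewrite (_ : l = i) ?(negbTE nAi) //; apply: val_inj.
apply/eqP; rewrite -subr_eq0 -diffs_sub; apply/eqP.
pose g := [eta shift A f x j with i |-> x].
rewrite -(IH (A :\ i) g s h) //; last by move: leAk; rewrite (cardsD1 i) Ai.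
congr (diffs _ _ _); apply: funext => z.
apply/eqP; rewrite subr_eq; apply/eqP.
pose f' := fun k => (if k \in A then z else 0) + shift A f x j k.
have -> : affine A (shift A f x j.+1) z = phi [eta f' with i |-> x + (z + f i)].
  congr phi; apply: funext => l /=; rewrite /f' /shift ltnS leq_eqVlt.
  have [->|il] := eqVneq l i; first by rewrite Ai eqxx /= addrCA.
  by rewrite -[l == j :> nat]/(l == i) (negbTE il).
rewrite multilinearD; congr (phi _ + phi _); apply: funext => l /=.
  by rewrite !inE /f'; have [->|//] := eqVneq l i; rewrite add0r.
rewrite /f' /shift; have [->|//] := eqVneq l i.
by rewrite Ai ltnn /= add0r.
Qed.

Lemma diffs_diag s h : size s = n.+1 -> diffs s (fun x => phi (fun=> x)) h = 0.
Proof.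
move=> sizes; rewrite -[RHS](@diffs_affine n.+1 [set: 'I_n]%SET (fun=> 0) s h) //;
  last first.
  by rewrite cardsT card_ord.
congr (diffs _ _ _); apply: funext => x; congr phi; apply: funext => i.
by rewrite inE addr0.
Qed.

End Homogeneous.

(** * Scaling and vanishing differences of homogeneous polynomials *)

Section Polynomials.
Context {R : realType} {E : vectorLatticeType R} {Y : lmodType R}.
Variables (n : nat) (P : E -> Y).
Hypothesis Ppoly : homogeneous_polynomial n P.

Lemma hpoly_scale a x : P (a *: x) = a ^+ n *: P x.
Proof. by case: Ppoly => phi phi_lin PE; rewrite !PE diag_scale. Qed.

Lemma hpoly_double x : P (x *+ 2) = P x *+ (2 ^ n).
Proof. by rewrite -scaler_nat hpoly_scale -natrX scaler_nat. Qed.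

Lemma hpoly0 : (0 < n)%N -> P 0 = 0.
Proof. by move=> n0; rewrite -(scale0r 0) hpoly_scale expr0n gtn_eqF ?scale0r. Qed.

Lemma diffs_hpoly s h : (n < size s)%N -> diffs s P h = 0.
Proof.
case: Ppoly => phi phi_lin PE; have -> : P = fun x => phi (fun=> x) by apply: funext.
elim: s h => // x s IH h; rewrite ltnS leq_eqVlt => /orP[/eqP ns|ns].
  by rewrite diffs_diag //= ns.
by rewrite /= /diff !IH ?subrr.
Qed.

End Polynomials.

(** * Separated bornologies *)

Section Separated.
Context {R : realType} {Y : convexBornologicalType R}.

(* The line through y lies in the balanced hull of the natural multiples of y. *)
Lemma separated_muln_bounded (B : set Y) (y : Y) : separated_bornology Y ->
  bornology B -> (forall N, B (y *+ N)) -> y = 0.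
Proof.
move=> sepY bB By; pose U : set Y := [set t *: y | t in [set: R]]%classic.
suff U0 : U = [set 0]%classic.
  have : U y by exists 1; rewrite ?scale1r.
  by rewrite U0.
apply: sepY.
  split; first by rewrite inE; exists 0; rewrite ?scale0r.
  move=> a _ _ /set_mem[t _ <-] /set_mem[t' _ <-]; apply/mem_set.
  by exists (a * t + t'); rewrite // scalerDl scalerA.
apply: (bornologyS _ _ _ (bornology_balanced _ bB)) => _ [t _ <-].
move=> C [Cbal BC].
have [N ltN] : exists N, `|t| < N.+1%:R.
  exists (Num.bound `|t|); apply: lt_trans (archi_boundP (normr_ge0 t)) _.
  by rewrite ltr_nat.
have -> : t *: y = (t / N.+1%:R) *: (y *+ N.+1).
  by rewrite -scaler_nat scalerA divfK ?pnatr_eq0.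
apply: (Cbal (t / N.+1%:R) _ _); last by exists (y *+ N.+1) => //; apply: BC.
by rewrite normrM normfV [`|N.+1%:R|]ger0_norm // ler_pdivrMr // mul1r ltW.
Qed.

End Separated.

(** * From disjoint additivity to the valuation identity *)

Section OrthogonallyAdditive.
Context {R : realType} {E : vectorLatticeType R} {Y : convexBornologicalType R}.
Variables (n : nat) (P : E -> Y).
Hypothesis sepY : separated_bornology Y.
Hypothesis Ppoly : homogeneous_polynomial n P.
Hypothesis Padd : forall x y, 0 <= x -> 0 <= y -> vmeet x y = 0 ->
  P (x + y) = P x + P y.

Definition bounded_on_intervals (F : E -> Y) :=
  forall c, exists2 B : set Y, bornology B & forall x, 0 <= x <= c -> B (F x).

Hypothesis Pbnd : bounded_on_intervals P.
Implicit Types (x y h c : E) (s u v w : seq E).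

Lemma bounded_diffs s : (forall x, x \in s -> 0 <= x) ->
  bounded_on_intervals (diffs s P).
Proof.
elim: s => //= x s IH s0 c.
have x0 : 0 <= x by rewrite s0 ?mem_head.
have [B bB FB] : exists2 B, bornology B & forall y, 0 <= y <= c + x -> B (diffs s P y).
  by apply: IH => y sy; rewrite s0 // inE sy orbT.
(* Differences of elements of [B], written so that the axioms for sums and scalar multiples
   apply. *)
exists [set y + z | y in B & z in [set -1 *: y | y in B]]%classic.
  exact/bornologyD/bornologyZ.
move=> y /andP[y0 yc]; exists (diffs s P (y + x)).
  by apply: FB; rewrite addv_ge0 ?levD.
exists (- diffs s P y); last by [].
exists (diffs s P y); last by rewrite scaleN1r.
by apply: FB; rewrite y0 -[y]addr0 levD.
Qed.

(** The defect in [diffsD] has order above [n] and vanishes; this is the additivity of the form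
    Phi. *)
Lemma diffs_additive x y s : size s = n.-1 ->
  diffs (x + y :: s) P 0 = diffs (x :: s) P 0 + diffs (y :: s) P 0.
Proof.
move=> sizes; rewrite diffsD (@diffs_hpoly _ _ _ n P Ppoly [:: x, y & s]) ?addr0 //=.
by rewrite sizes !ltnS leqSpred.
Qed.

Lemma diffs_additiveMn x N s : size s = n.-1 ->
  diffs (x *+ N :: s) P 0 = diffs (x :: s) P 0 *+ N.
Proof.
move=> sizes; elim: N => [|N IH]; first by rewrite !mulr0n /= /diff addr0 subrr.
by rewrite !mulrS diffs_additive ?IH.
Qed.

(** By additivity [N] times the value at [x] is the value at [vmeet (x *+ N) h], a difference of two
    values of [diffs s P] on the interval from 0 to [h]. All multiples lie in one bounded set, and
    separation applies. *)
Lemma diffs_truncation x h s : 0 <= x -> 0 <= h ->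
    (forall y, y \in s -> 0 <= y) -> size s = n.-1 ->
    (forall N, diffs (x *+ N - vmeet (x *+ N) h :: s) P 0 = 0) ->
  diffs (x :: s) P 0 = 0.
Proof.
move=> x0 h0 s0 sizes trunc0; have [B bB PB] := bounded_diffs s0 h.
apply: (@separated_muln_bounded _ _
  [set y + z | y in B & z in [set -1 *: y | y in B]]%classic) => //.
  exact/bornologyD/bornologyZ.
move=> N; rewrite -diffs_additiveMn // -[x *+ N](subrK (vmeet (x *+ N) h)).
rewrite diffs_additive // trunc0 add0r /= /diff add0r.
set m := vmeet _ _; have m0 : 0 <= m by rewrite lev_meet mulvn_ge0.
exists (diffs s P m); first by apply: PB; rewrite m0 vmeet_ler.
exists (- diffs s P 0); last by [].
by exists (diffs s P 0); [apply: PB; rewrite lexx | rewrite scaleN1r].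
Qed.

Lemma diffs_disjoint u v : u != [::] -> v != [::] ->
    (forall x, x \in u -> 0 <= x) -> (forall y, y \in v -> 0 <= y) ->
    (forall x y, x \in u -> y \in v -> vmeet x y = 0) ->
  diffs (u ++ v) P 0 = 0.
Proof.
move=> u0 v0 upos vpos uv0.
(* [X] and [Z] are sum-closed, mutually disjoint sets of positive elements containing [u] and [v],
   so [P] splits on their sums. *)
pose X x := 0 <= x /\ forall y, y \in v -> vmeet x y = 0.
pose Z y := 0 <= y /\ forall x, X x -> vmeet x y = 0.
apply: (@diffs_cat_eq0 _ _ X Z) => //.
- move=> x y [x0 xv] [y0 yv]; split; first exact: addv_ge0.
  by move=> z vz; apply: vmeet0D => //; [exact: vpos | exact: xv | exact: yv].
- by split=> // y vy; rewrite vmeet_l ?vpos.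
- move=> y z [y0 yX] [z0 zX]; split; first exact: addv_ge0.
  move=> x Xx; have [x0 _] := Xx.
  by rewrite vmeetC vmeet0D // vmeetC; [apply: yX | apply: zX].
- by split=> // x [x0 _]; rewrite vmeetC vmeet_l.
- by move=> x y Xx [y0 yX]; rewrite Padd ?yX //; case: Xx.
- by move=> x ux; split=> [|y vy]; [exact: upos | exact: uv0].
- by move=> y vy; split=> [|x [_ xv]]; [exact: vpos | exact: xv].
Qed.

(** The pair keeps the multiplicity and the element, as the sum [M] below is built from the
    multiples themselves. *)
Definition truncation h (q : nat * E) : E := q.2 *+ q.1 - vmeet (q.2 *+ q.1) h.

Lemma diffs_disjoint_cat s u v : u != [::] -> v != [::] ->
    (forall x, x \in s ++ u ++ v -> 0 <= x) ->
    (forall x y, x \in u -> y \in v -> vmeet x y = 0) ->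
    size (s ++ u ++ v) = n ->
  diffs (s ++ u ++ v) P 0 = 0.
Proof.
elim: s u v => [|h s IH] u v u0 v0 pos uv0 sizen.
  by apply: (@diffs_disjoint u v) => // x xu; apply: pos; rewrite !mem_cat xu !orbT.
have h0 : 0 <= h by rewrite pos ?mem_head.
have s0 x : x \in s -> 0 <= x.
  by move=> sx; rewrite pos // !(inE, mem_cat) sx !orbT.
have vpos x : x \in v -> 0 <= x.
  by move=> vx; rewrite pos // !(inE, mem_cat) vx !orbT.
(* First case, with the whole group next to [v] truncated at [h]: [h1] lies below [M], which is
   disjoint from [v], and joins the truncations; [h - h1] is disjoint from the truncations and joins
   [v]. *)
have truncated p : p != [::] ->
    (forall q, q \in p -> 0 <= q.2) ->
    (forall q y, q \in p -> y \in v -> vmeet q.2 y = 0) ->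
    size (h :: s ++ map (truncation h) p ++ v) = n ->
    diffs (h :: s ++ map (truncation h) p ++ v) P 0 = 0.
  move=> p0 ppos pv0 psize; set t := map _ p.
  pose M := \sum_(q <- p) q.2 *+ q.1; pose h1 := vmeet h M.
  have Mpos q : q \in p -> 0 <= q.2 *+ q.1 by move=> /ppos; apply: mulvn_ge0.
  have M0 : 0 <= M by apply: sumv_ge0.
  have tpos x : x \in t -> 0 <= x.
    by move=> /mapP[q _ ->]; rewrite subv_ge0 vmeet_lel.
  have tv0 x y : x \in t -> y \in v -> vmeet x y = 0.
    move=> tx vy; have x0 := tpos x tx; case/mapP: tx x0 => q pq -> x0.
    apply: (@vmeet_eq0_le _ _ _ _ (q.2 *+ q.1) y) => //; first exact: vpos.
      by rewrite lev_BlDr -[leLHS]addr0 lev_D2l lev_meet Mpos.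
    by apply: vmeet0_muln; [exact: ppos | exact: vpos | exact: pv0].
  have h1pos : 0 <= h1 by rewrite lev_meet h0.
  have h2pos : 0 <= h - h1 by rewrite subv_ge0 vmeet_lel.
  have tn0 : t != [::] by rewrite /t; case: (p) p0.
  rewrite -[h](subrK h1) addrC diffs_additive; last by rewrite -psize.
  have -> : diffs (h1 :: s ++ t ++ v) P 0 = 0.
    have tperm : perm_eq (h1 :: s ++ t ++ v) (s ++ (h1 :: t) ++ v).
      by apply/permP => a; rewrite /= !count_cat /= count_cat addnCA.
    rewrite (perm_diffs _ tperm); apply: IH => //.
    - move=> x; rewrite -(perm_mem tperm) inE => /orP[/eqP->//|].
      by rewrite !mem_cat => /or3P[/s0|/tpos|/vpos].
    - move=> x y; rewrite inE => /orP[/eqP-> vy|]; last exact: tv0.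
      apply: (@vmeet_eq0_le _ _ _ _ M y) => //; first exact: vpos.
        exact: vmeet_ler.
      apply: vmeet0_sum => [|q pq]; first exact: vpos.
      split; first exact: Mpos.
      by apply: vmeet0_muln; [exact: ppos | exact: vpos | exact: pv0].
    by rewrite -(perm_size tperm) -psize.
  rewrite add0r.
  have tperm : perm_eq (h - h1 :: s ++ t ++ v) (s ++ t ++ (h - h1 :: v)).
    apply/permP => a; rewrite /= !count_cat /=.
    by rewrite addnCA; congr addn; rewrite addnCA.
  rewrite (perm_diffs _ tperm); apply: IH => //.
  - move=> x; rewrite -(perm_mem tperm) inE => /orP[/eqP->//|].
    by rewrite !mem_cat => /or3P[/s0|/tpos|/vpos].
  - move=> x y tx; rewrite inE => /orP[/eqP->|]; last exact: tv0.
    have x0 := tpos x tx; case/mapP: tx x0 => q pq -> x0.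
    (* [M] dominates the multiple, so [h1] dominates the meet of that multiple with [h]. *)
    apply: vmeet_eq0_le (vmeet_subm (q.2 *+ q.1) h) => //.
    rewrite levD // lev_N2 /h1 lev_meet vmeet_ler /=.
    apply: le_trans (vmeet_lel _ _) _.
    exact: (@lev_sum_elem _ _ _ p (fun q => q.2 *+ q.1)).
  by rewrite -(perm_size tperm) -psize.
(* Truncations are removed one at a time: [w] lists plain elements, [p] truncated ones. For [x] to
   be plain, the vanishing is needed with [x] truncated at every multiplicity [N]; the induction on
   [w] gives it with [(N, x)] moved to [p]. *)
suff untruncate w p : w ++ unzip2 p != [::] ->
    (forall x, x \in w ++ unzip2 p -> 0 <= x) ->
    (forall x y, x \in w ++ unzip2 p -> y \in v -> vmeet x y = 0) ->
    size (h :: s ++ (w ++ unzip2 p) ++ v) = n ->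
    diffs (h :: s ++ (w ++ map (truncation h) p) ++ v) P 0 = 0.
  rewrite -[u]cats0; apply: (untruncate u [::]); rewrite cats0 // => x ux.
  by rewrite pos // !(inE, mem_cat) ux !orbT.
elim: w p => [|x w IHw] p p0 ppos pv0 psize.
  apply: truncated.
  - by case: (p) p0.
  - by move=> q pq; apply: ppos; apply: map_f.
  - by move=> q y pq; apply: pv0; apply: map_f.
  - by rewrite -psize /= !size_cat !size_map.
set t := s ++ (w ++ map (truncation h) p) ++ v.
have x0 : 0 <= x by rewrite ppos ?mem_head.
have -> : diffs (h :: s ++ ((x :: w) ++ map (truncation h) p) ++ v) P 0 =
    diffs (x :: h :: t) P 0.
  apply: (congr1 (@^~ 0)); apply: perm_diffs; apply/permP => a.
  by rewrite /t /= !count_cat /= ?count_cat; lia.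
apply: (@diffs_truncation _ h) => //.
- move=> y; rewrite /t !(inE, mem_cat).
  move=> /orP[/eqP->//|/or3P[/s0//|/orP[wy|/mapP[q _ ->]]|/vpos//]].
    by rewrite ppos // !(inE, mem_cat) wy orbT.
  by rewrite subv_ge0 vmeet_lel.
- by rewrite -psize /t /= !size_cat /= ?size_cat !size_map; lia.
move=> N; have {}IHw := IHw ((N, x) :: p).
have xperm : perm_eq (x :: w ++ unzip2 p) (w ++ unzip2 ((N, x) :: p)).
  by apply/permP => a; rewrite /= !count_cat /= addnCA.
rewrite -[RHS]IHw.
- apply: (congr1 (@^~ 0)); apply: perm_diffs; apply/permP => a.
  by rewrite /t /= !count_cat /= ?count_cat /= /truncation /=; lia.
- by rewrite -size_eq0 -(perm_size xperm).
- by move=> y; rewrite -(perm_mem xperm); apply: ppos.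
- by move=> y z; rewrite -(perm_mem xperm); apply: pv0.
- by rewrite -psize /= !size_cat /= ?size_cat /=; lia.
Qed.

(** Both [h] and 0 reach [vjoin h 0] by adding a positive element, which leaves the value
    unchanged. *)
Lemma diffs_const t : (forall g h, 0 <= g -> diffs (g :: t) P h = 0) ->
  forall h, diffs t P h = diffs t P 0.
Proof.
move=> dt0 h; have dE g x : 0 <= g -> diffs t P (x + g) = diffs t P x.
  by move=> g0; apply/eqP; rewrite -subr_eq0; apply/eqP/dt0.
rewrite -(dE (vjoin h 0 - h)) ?subv_ge0 ?vjoin_gel // addrC subrK.
by rewrite -[vjoin h 0]add0r dE ?vjoin_ger.
Qed.

(* Once the differences of one order higher vanish, these are both
   homogeneous of degree [(size w).+2] and, like P, of degree n. *)
Lemma mixed_diffs a b w h : 0 <= a -> 0 <= b -> vmeet a b = 0 ->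
  (forall x, x \in w -> 0 <= x) -> diffs [:: a, b & w] P h = 0.
Proof.
(* Downward induction on the order: [m] bounds the gap between [size w] and [n], and at [m = 0] the
   order exceeds [n]. *)
have [m lenm] : exists m, (n <= size w + m)%N by exists n; rewrite leq_addl.
elim: m a b w h lenm => [|m IH] a b w h lenm a0 b0 ab0 w0.
  by apply: (diffs_hpoly Ppoly); rewrite /=; lia.
have {}IH a' b' w' g x : 0 <= a' -> 0 <= b' -> vmeet a' b' = 0 ->
    (forall x, x \in w' -> 0 <= x) -> size w' = size w -> 0 <= g ->
    diffs [:: g, a', b' & w'] P x = 0.
  move=> a'0 b'0 ab'0 w'0 sizew' g0.
  have gperm : perm_eq [:: g, a', b' & w'] [:: a', b', g & w'].
    by apply/permP => p /=; lia.
  rewrite (perm_diffs _ gperm) IH //; first by rewrite /= sizew'; lia.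
  by move=> y; rewrite inE => /orP[/eqP->|/w'0].
rewrite diffs_const; last by move=> g x g0; apply: IH.
have [ltwn|] := ltnP n (size w).+2; first exact: (diffs_hpoly Ppoly).
rewrite leq_eqVlt => /orP[/eqP sizew|ltwn].
  have wperm : perm_eq [:: a, b & w] (w ++ [:: a] ++ [:: b]).
    by apply/permP => p; rewrite /= count_cat /=; lia.
  rewrite (perm_diffs _ wperm); apply: diffs_disjoint_cat => //.
  - by move=> x; rewrite -(perm_mem wperm) !inE => /or3P[/eqP->|/eqP->|/w0].
  - by move=> x y; rewrite !inE => /eqP-> /eqP->.
  - by rewrite size_cat /=; lia.
pose dbl (x : E) := x *+ 2.
have dbl0 x : 0 <= x -> 0 <= dbl x by apply: mulvn_ge0.
(* Doubling an entry of [w] doubles the value: the defect contains that entry twice and has one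
   order more, so the induction hypothesis kills it. *)
have dblw w1 w2 : (forall x, x \in w1 ++ w2 -> 0 <= x) ->
    size (w1 ++ w2) = size w ->
    diffs [:: a, b & map dbl w1 ++ w2] P 0 =
    diffs [:: a, b & w1 ++ w2] P 0 *+ 2 ^ size w1.
  elim: w1 w2 => [|x w1 IHw] w2 w120 sizew; first by [].
  rewrite map_cons !cat_cons [size _]/=.
  have x0 : 0 <= x by rewrite w120 ?mem_head.
  have xperm y : perm_eq [:: a, b & y :: map dbl w1 ++ w2]
      [:: y, a, b & map dbl w1 ++ w2] by apply/permP => p /=; lia.
  have xperm2 : perm_eq [:: a, b & map dbl w1 ++ (x :: w2)]
      [:: x, a, b & map dbl w1 ++ w2].
    by apply/permP => p; rewrite /= !count_cat /=; lia.
  have xperm3 : perm_eq [:: x, x, a, b & map dbl w1 ++ w2]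
      [:: x, a, b & map dbl w1 ++ (x :: w2)].
    by apply/permP => p; rewrite /= !count_cat /=; lia.
  have xperm4 : perm_eq (x :: w1 ++ w2) (w1 ++ x :: w2).
    by apply/permP => p; rewrite /= !count_cat /=; lia.
  rewrite (perm_diffs _ (xperm _)) {1}/dbl mulr2n diffsD.
  rewrite (perm_diffs _ xperm3) [X in _ + X]IH //; last 2 first.
  - move=> y; rewrite mem_cat inE => /or3P[/mapP[z w1z ->]|/eqP->//|w2y].
      by apply/dbl0/w120; rewrite inE mem_cat w1z orbT.
    by apply: w120; rewrite inE mem_cat w2y !orbT.
  - by rewrite -sizew !size_cat /= size_map; lia.
  rewrite addr0 -mulr2n -(perm_diffs _ xperm2) IHw.
  - rewrite -mulrnA mulnC -expnS; congr (_ *+ _).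
    by rewrite (@perm_diffs _ _ [:: a, b & x :: w1 ++ w2]
      [:: a, b & w1 ++ x :: w2]) // !perm_cons.
  - by move=> y; rewrite -(perm_mem xperm4); apply: w120.
  - by rewrite -(perm_size xperm4).
(* For [a] and [b] the extra copy in the defect plays the part of [g] beside the disjoint pair. *)
have dblb : diffs [:: dbl a, dbl b & map dbl w] P 0 =
    diffs [:: a, b & map dbl w] P 0 *+ 2 ^ 2.
  have dw0 x : x \in map dbl w -> 0 <= x by move=> /mapP[y /w0 y0 ->]; apply: dbl0.
  have ab20 : vmeet a (dbl b) = 0 by rewrite vmeetC vmeet0_muln // vmeetC.
  rewrite {1}/dbl [a *+ 2]mulr2n diffsD IH ?size_map ?dbl0 // addr0 -mulr2n.
  have bperm y : perm_eq [:: a, y & map dbl w] [:: y, a & map dbl w].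
    by apply/permP => p /=; lia.
  rewrite (perm_diffs _ (bperm _)) {1}/dbl [b *+ 2]mulr2n diffsD.
  have bperm2 : perm_eq [:: b, b, a & map dbl w] [:: b, a, b & map dbl w].
    by apply/permP => p /=; lia.
  rewrite (perm_diffs _ bperm2) [X in _ + X]IH ?size_map // addr0 -mulr2n.
  by rewrite -(perm_diffs _ (bperm _)) -mulrnA.
(* Doubling everything multiplies the value by [2 ^ n] by homogeneity and by [2 ^ (size w).+2] slot
   by slot; the exponents differ, so the value is 0. *)
have := diffs_double [:: a, b & w] 0 (hpoly_double Ppoly).
rewrite /= mul0rn; move: dblb; rewrite /= => ->.
have := dblw w [::]; rewrite !cats0 /= => -> //.
rewrite -mulrnA -expnD addn2 => /eqP.
set c := diff a _ 0; rewrite -subr_eq0 -![c *+ _]scaler_nat -scalerBl.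
rewrite scaler_eq0 subr_eq0 eqr_nat => /orP[|/eqP//].
by rewrite eqn_exp2l // => /eqP sizew; move: ltwn; rewrite sizew ltnn.
Qed.

Lemma valuation x y : P (vmeet x y) + P (vjoin x y) = P x + P y.
Proof.
set m := vmeet x y; have mx : m + (x - m) = x by rewrite addrC subrK.
have my : m + (y - m) = y by rewrite addrC subrK.
have mxy : x + (y - m) = vjoin x y.
  by rewrite addrA -(vmeetDjoin x y) -/m addrAC subrr add0r.
have := @mixed_diffs (x - m) (y - m) [::] m.
rewrite /= /diff mx my mxy => /(_ _ _ (vmeet_subm x y)).
rewrite !subv_ge0 vmeet_lel vmeet_ler => /(_ isT isT).
have nil0 z : z \in [::] -> (0 : E) <= z by [].
move=> /(_ nil0)/eqP; rewrite subr_eq0 subr_eq => /eqP ->.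
by rewrite addrA [P m + _]addrC subrK addrC.
Qed.

End OrthogonallyAdditive.

(** * Power sums under sorting, and signed disjoint pairs *)

Section PowerSums.
Context {R : realType} {E : vectorLatticeType R}.
Implicit Types (a b x y : E).

(** Each comparator replaces a pair by its meet and join, which keeps the sum. *)
Lemma sum_vsort {Y : zmodType} (P : E -> Y) s :
    (forall x y, P (vmeet x y) + P (vjoin x y) = P x + P y) ->
  \sum_(x <- vsort s) P x = \sum_(x <- s) P x.
Proof.
move=> Pval; have insertE x t :
    \sum_(y <- vinsert x t) P y = P x + \sum_(y <- t) P y.
  elim: t x => [|y t IH] x; first by rewrite big_seq1 big_nil addr0.
  by rewrite !big_cons IH addrA Pval addrA.
by elim: s => // x s IH; rewrite [vsort _]/= insertE IH big_cons.
Qed.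

Lemma orderization_sum {Y : zmodType} (P : E -> Y) r (f : 'I_r -> E) :
  \sum_(k < r) P (orderization f k) = \sum_(x <- vsort (codom f)) P x.
Proof.
have sizes : size (vsort (codom f)) = r.
  by rewrite size_vsort size_map size_enum_ord.
rewrite (big_nth 0) big_mkord sizes.
by apply: eq_bigr => k _; rewrite orderization_nth.
Qed.

Lemma sum_with2 {Y : zmodType} (P : E -> Y) r (g : 'I_r -> E) i j a b :
  i != j -> \sum_(k < r) P ([eta g with i |-> a, j |-> b] k) =
    P a + P b + \sum_(k < r | (k != i) && (k != j)) P (g k).
Proof.
move=> ij; rewrite (bigD1 i) //= (bigD1 j) /= 1?eq_sym //.
rewrite !eqxx [j == i]eq_sym (negbTE ij) addrA; congr (_ + _).
by apply: eq_bigr => k /andP[/negbTE-> /negbTE->].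
Qed.

Lemma orthogonally_steadyP {Y : lmodType R} (P : E -> Y) r
    (S : ('I_r -> E) -> Y) :
  (2 <= r)%N -> P 0 = 0 -> (forall f, S f = \sum_(k < r) P (f k)) ->
  orthogonally_steady S <->
  forall x y, vmeet (vabs x) (vabs y) = 0 -> P (x + y) = P x + P y.
Proof.
move=> r2 P0 SE; split=> [Ssteady x y xy0|Padd f i j ij fij0].
  pose i : 'I_r := Ordinal (ltnW r2); pose j : 'I_r := Ordinal r2.
  have ij : i != j by [].
  pose f := [eta (fun=> 0 : E) with i |-> x, j |-> y].
  have fi : f i = x by [].
  have fj : f j = y by [].
  have := Ssteady f i j ij; rewrite fi fj => /(_ xy0).
  rewrite !SE /f !sum_with2 // P0 add0r.
  set s1 := \sum_(k < r | _) _; set s2 := \sum_(k < r | _) _.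
  have -> : s1 = s2.
    by apply: eq_bigr => k /andP[/negbTE ki /negbTE kj] /=; rewrite ki kj.
  by move=> /addIr.
have fE : f = [eta f with i |-> f i, j |-> f j].
  by apply: funext => k /=; case: eqP => [->|_] //; case: eqP => [->|].
by rewrite !SE {1}fE !sum_with2 // P0 add0r Padd.
Qed.

(* For fixed disjoint a, b >= 0 the polynomial P (a + t b) - P a - P (t b)
   vanishes at t = 0, 1, 2, ..., hence at t = -1. *)
Lemma disjoint_sub {Y : lmodType R} n (P : E -> Y) a b :
    homogeneous_polynomial n P ->
    (forall x y, 0 <= x -> 0 <= y -> vmeet x y = 0 -> P (x + y) = P x + P y) ->
  0 <= a -> 0 <= b -> vmeet a b = 0 -> P (a - b) = P a + P (- b).
Proof.
move=> Ppoly Padd a0 b0 ab0.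
pose G x := diff a P x - P a.
(* Among the points entering the [k]-th difference along [b] at [- b], only [- b] itself is not a
   natural multiple of [b]. *)
have diffsG k (F : E -> Y) : (forall N, F (b *+ N) = 0) ->
    diffs (nseq k b) F (- b) = (-1 : R) ^+ k *: F (- b).
  elim: k F => [|k IH] F F0; first by rewrite scale1r.
  rewrite /= diff_diffs IH; last first.
    by move=> N; rewrite /diff -mulrSr !F0 subrr.
  rewrite /diff addNr -(mulr0n b) F0 sub0r exprSr -scalerA.
  by rewrite scaleN1r.
have GbN N : G (b *+ N) = 0.
  rewrite /G /diff [b *+ N + a]addrC Padd ?mulvn_ge0 //.
    by rewrite addrK subrr.
  by rewrite vmeetC vmeet0_muln // vmeetC.
(* Up to a constant [G] is a first difference of [P], so this is a difference of [P] of order [n.+2]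
   and vanishes. *)
have := diffsG n.+1 G GbN; rewrite diffs_sub diffs_cst // subr0.
rewrite -diff_diffs (_ : diff a _ = diffs (a :: nseq n.+1 b) P) //.
rewrite (diffs_hpoly Ppoly) /= ?size_nseq // => /esym/eqP.
rewrite scaler_eq0 signr_eq0 /= /G /diff subr_eq0 subr_eq => /eqP.
by rewrite addrC.
Qed.

(** Positive and negative parts reduce signed pairs to positive ones: [x + y] is the sum of the
    positive parts minus the sum of the negative parts, these sums are disjoint, and [disjoint_sub]
    splits [P] there. *)
Lemma orthogonally_additive {Y : lmodType R} n (P : E -> Y) :
    homogeneous_polynomial n P ->
    (forall x y, 0 <= x -> 0 <= y -> vmeet x y = 0 -> P (x + y) = P x + P y) ->
  forall x y, vmeet (vabs x) (vabs y) = 0 -> P (x + y) = P x + P y.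
Proof.
move=> Ppoly Padd x y xy0.
pose m (z : E) := vmeet z 0; pose p z := z - m z; pose q z := - m z.
have p0 z : 0 <= p z by rewrite subv_ge0 vmeet_lel.
have q0 z : 0 <= q z by rewrite /q -sub0r subv_ge0 vmeet_ler.
have pq0 z : vmeet (p z) (q z) = 0.
  by have := vmeet_subm z 0; rewrite sub0r.
have pqE z : p z - q z = z by rewrite /p /q opprK subrK.
have abs0 z : 0 <= vabs z.
  have -> : vabs z = 2%:R^-1 *: (vabs z + vabs z).
    by rewrite -mulr2n -scaler_nat scalerA mulVf ?scale1r ?pnatr_eq0.
  rewrite scalev_ge0 ?invr_ge0 ?ler0n // -(subrr z).
  by apply: levD; [exact: vjoin_gel | exact: vjoin_ger].
have p_le z : p z <= vabs z.
  rewrite /p lev_BlDr addrC -lev_BlDr lev_meet !lev_BlDr add0r.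
  by rewrite vjoin_gel -[leLHS]addr0 lev_D2l abs0.
have q_le z : q z <= vabs z.
  rewrite /q -lev_N2 opprK lev_meet.
  by apply/andP; split; rewrite -lev_N2 opprK ?oppr0 //; apply: vjoin_ger.
have PN z : P (- z) = (-1) ^+ n *: P z by rewrite -scaleN1r (hpoly_scale Ppoly).
have PE z : P z = P (p z) + (-1) ^+ n *: P (q z).
  by rewrite -[in LHS](pqE z) (disjoint_sub Ppoly Padd) ?PN.
have disj u v : 0 <= u -> 0 <= v -> u <= vabs x -> v <= vabs y -> vmeet u v = 0.
  by move=> u0 v0 ux vy; apply: vmeet_eq0_le xy0.
have -> : x + y = (p x + p y) - (q x + q y).
  by rewrite opprD addrACA !pqE.
have pxy0 := addv_ge0 (p0 x) (p0 y); have qxy0 := addv_ge0 (q0 x) (q0 y).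
rewrite (disjoint_sub Ppoly Padd pxy0 qxy0); last first.
  apply: vmeet0D => //; rewrite vmeetC; apply: vmeet0D => //.
  - by rewrite vmeetC.
  - by rewrite vmeetC; apply: disj.
  - exact: disj.
  - by rewrite vmeetC.
rewrite PN (Padd (p x) (p y)) ?disj // (Padd (q x) (q y)) ?disj //.
rewrite (PE x) (PE y) scalerDr.
by rewrite addrACA.
Qed.

End PowerSums.

(** * The cycle of implications from (i) through (ii) and (iii) back to (i) *)

Theorem theorem3p21 (R : realType) (n r : nat)
    (E : vectorLatticeType R) (Y : convexBornologicalType R)
    (S : ('I_r -> E) -> Y) :
  (0 < n)%N -> (2 <= r)%N ->
  nontrivial E -> archimedean E -> unif_complete E ->
  separated_bornology Y ->
  power_sum_polynomial n S -> bounded_map S ->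
  [<-> orthogonally_steady S;
       total_orderization_invariant S;
       positively_total_orderization_invariant S].
Proof.
move=> n0 r2 _ _ _ sepY [P Ppoly SE] Sbnd.
have P0 : P 0 = 0 by apply: hpoly0 Ppoly n0.
have steadyP := orthogonally_steadyP r2 P0 SE.
tfae.
- move=> /steadyP Padd f; rewrite !SE orderization_sum sum_vsort; last first.
    apply: (valuation sepY Ppoly) => [x y x0 y0 xy0|c].
      by rewrite Padd // !vabs_ge0.
    (* With [x] in one position and 0 elsewhere [S] takes the value [P x], so boundedness passes to
       [P]. *)
    pose i : 'I_r := Ordinal (ltnW r2).
    pose B (k : 'I_r) := [set x : E | 0 <= x <= if k == i then c else 0]%classic.
    have Bob k : order_bounded (B k) by exists 0, (if k == i then c else 0).
    exists (S @` [set f | forall k, B k (f k)])%classic; first exact: Sbnd.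
    move=> x x0c; exists [eta (fun=> 0) with i |-> x].
      by move=> k; rewrite /B /=; case: eqP => _ //; rewrite lexx.
    rewrite SE (bigD1 i) //= big1 ?addr0 // => k /negbTE ki.
    by rewrite ki.
  by rewrite big_map big_enum.
- by move=> Sinv f _; apply: Sinv.
- move=> Sinv; apply/steadyP/(orthogonally_additive Ppoly) => a b a0 b0 ab0.
  (* Padding by [r.-2] zeros gives length [r]; sorting then merges [a] and [b] into [a + b]. *)
  pose s := nseq r.-2 0 ++ [:: a; b]; pose f (i : 'I_r) := nth 0 s i.
  have sizes : size s = r by rewrite size_cat size_nseq /=; lia.
  have codomf : codom f = s.
    rewrite /codom /image_mem (eq_map (_ : f =1 nth 0 s \o val)) // map_comp.
    by rewrite val_enum_ord -/(mkseq _ _) -sizes mkseq_nth.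
  have f0 k : 0 <= f k.
    have : f k \in s by rewrite mem_nth // sizes.
    by rewrite mem_cat mem_nseq !inE => /orP[/andP[_ /eqP->]|/orP[]/eqP->].
  have := Sinv f f0; rewrite !SE orderization_sum codomf vsort_disjoint //.
  have -> : \sum_(k < r) P (f k) = \sum_(x <- s) P x.
    by rewrite -codomf big_map big_enum.
  have sum0 k t : \sum_(x <- nseq k 0 ++ t) P x = \sum_(x <- t) P x.
    by elim: k => //= k IH; rewrite big_cons P0 add0r.
  by rewrite !sum0 !big_cons !big_nil !addr0 => <-.
Qed.
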